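(* Let $\tau>0$, $c>0$, $\lambda\in\mathbb{R}$, $T>0$, $a,b>0$, and consider the wave equation with constant time delay $u_{tt}=c^2u_{xx}+\lambda u(x,t-\tau)$ on the spatial interval $(-a,b)$ with prescribed history function and Dirichlet boundary conditions at $x=-a$ and $x=b$. Consider the Dirichlet-Neumann waveform relaxation (DNWR) error iteration with relaxation parameter $\theta$ for this problem on the two subdomains $\Omega_1=(-a,0)$ and $\Omega_2=(0,b)$, started from an admissible initial interface error $h^0$. Suppose the subdomains are of equal size, i.e. $a=b$. Then: (i) for $0<\theta<1$, $\theta\neq 1/2$, the DNWR iteration converges linearly; (ii) for $\theta=1/2$, the DNWR iteration converges within two iterations, for every time window length $T>0$.
   Context: DNWR error iteration. Since the problem is linear, the iteration is written for the error, i.e. with zero history and zero boundary data. Given $h^0:[0,T]\to\mathbb{R}$ (initial error on the interface $\{x=0\}$), for $k=1,2,\dots$ let $e_1^k$ solve the Dirichlet problem $$\partial_{tt}e_1^k-c^2\partial_{xx}e_1^k-\lambda e_1^k(x,t-\tau)=0\text{ in }\Omega_1\times(0,T),$$ $$e_1^k=\partial_te_1^k=0\text{ on }\Omega_1\times[-\tau,0],\quad e_1^k(-a,t)=0,\quad e_1^k(0,t)=h^{k-1}(t),\ t\in(0,T);$$ then let $e_2^k$ solve the Neumann problem $$\partial_{tt}e_2^k-c^2\partial_{xx}e_2^k-\lambda e_2^k(x,t-\tau)=0\text{ in }\Omega_2\times(0,T),$$ $$e_2^k=\partial_te_2^k=0\text{ on }\Omega_2\times[-\tau,0],\quad \partial_xe_2^k(0,t)=\partial_xe_1^k(0,t),\quad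 e_2^k(b,t)=0,\ t\in(0,T);$$ and update $h^k(t)=\theta e_2^k(0,t)+(1-\theta)h^{k-1}(t)$. Regularity conventions. Solutions are classical: continuous on $\overline{\Omega_i}\times[-\tau,T]$ and twice continuously differentiable on $\overline{\Omega_i}\times[0,T]$. An initial interface error $h^0$ is admissible if it is continuous on $[0,T]$ and all iterates $e_i^k$ exist as such classical solutions. Convergence. Let $\|h\|=\sup_{t\in[0,T]}|h(t)|$. The iteration converges linearly if, for every admissible $h^0\not\equiv0$, there is $\rho\in(0,1)$ with $h^{k}\not\equiv 0$ for all $k$ and $\lim_{k\to\infty}\|h^{k}\|/\|h^{k-1}\|=\rho$ (so in particular $h^k\to0$). It converges within two iterations if, for every admissible $h^0$, the errors $e_1^k$, $e_2^k$ and $h^k$ vanish identically for all $k\ge2$. *)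

(* Defs.v *)
(* Stdlib real numbers with Coquelicot. *)
From Stdlib Require Import Reals.
From Coquelicot Require Import Coquelicot.
Open Scope R_scope.

Definition closed_interval (p q : R) : R -> Prop := fun x => p <= x <= q.

Definition rectangle (I J : R -> Prop) : R * R -> Prop :=
  fun p => I (fst p) /\ J (snd p).

(* Derivative at [x] of a function considered on the set [I] only: the usual
   derivative at interior points of an interval, the one-sided derivative at
   its endpoints. *)
Definition is_derive_on (I : R -> Prop) (f : R -> R) (x l : R) : Prop :=
  filterdiff f (within I (locally x)) (fun h : R => scal h l).

Definition ex_derive_on (I : R -> Prop) (f : R -> R) (x : R) : Prop :=
  exists l : R, is_derive_on I f x l.

(* Total operator; meaningless where [ex_derive_on I f x] fails. *)
Definition Derive_on (I : R -> Prop) (f : R -> R) (x : R) : R :=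
  iota (is_derive_on I f x).

(* Functions of (x, t) are curried, with the space variable first. *)
Definition Dx (I : R -> Prop) (u : R -> R -> R) : R -> R -> R :=
  fun x t => Derive_on I (fun y => u y t) x.

Definition Dt (J : R -> Prop) (u : R -> R -> R) : R -> R -> R :=
  fun x t => Derive_on J (fun s => u x s) t.

Definition continuous_on2 (I J : R -> Prop) (u : R -> R -> R) : Prop :=
  continuous_on (rectangle I J) (fun p : R * R => u (fst p) (snd p)).

Definition C1_on (I J : R -> Prop) (u : R -> R -> R) : Prop :=
  (forall x t, I x -> J t ->
     ex_derive_on I (fun y => u y t) x /\ ex_derive_on J (fun s => u x s) t) /\
  continuous_on2 I J (Dx I u) /\
  continuous_on2 I J (Dt J u).

Definition C2_on (I J : R -> Prop) (u : R -> R -> R) : Prop :=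
  C1_on I J u /\ C1_on I J (Dx I u) /\ C1_on I J (Dt J u).

(* Classical solution on (p, q) of
     e_tt - c^2 e_xx - lambda e(x, t - tau) = 0
   with zero history. The time derivative in the history condition is taken
   relative to [-tau, T], so at t = 0 it is two-sided; relative to [-tau, 0]
   it would impose no initial velocity. *)
Definition delay_wave_error (tau c lambda T p q : R) (e : R -> R -> R) : Prop :=
  let X := closed_interval p q in
  let J := closed_interval 0 T in
  continuous_on2 X (closed_interval (- tau) T) e /\
  C2_on X J e /\
  (forall x t, p < x < q -> 0 < t < T ->
     Dt J (Dt J e) x t - c ^ 2 * Dx X (Dx X e) x t
       - lambda * e x (t - tau) = 0) /\
  (forall x t, p < x < q -> - tau <= t <= 0 ->
     e x t = 0 /\
     is_derive_on (closed_interval (- tau) T) (fun s => e x s) t 0).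

Definition dirichlet_error (tau c lambda T a : R)
    (h : R -> R) (e1 : R -> R -> R) : Prop :=
  delay_wave_error tau c lambda T (- a) 0 e1 /\
  (forall t, 0 < t < T -> e1 (- a) t = 0 /\ e1 0 t = h t).

Definition neumann_error (tau c lambda T a b : R)
    (e1 e2 : R -> R -> R) : Prop :=
  delay_wave_error tau c lambda T 0 b e2 /\
  (forall t, 0 < t < T ->
     Dx (closed_interval 0 b) e2 0 t = Dx (closed_interval (- a) 0) e1 0 t /\
     e2 b t = 0).

(* [h k], [e1 k], [e2 k] are the k-th iterates; the subdomain errors start at
   k = 1, and [e1 0], [e2 0] are unused. *)
Definition dnwr_iteration (tau c lambda T a b theta : R) (h0 : R -> R)
    (h : nat -> R -> R) (e1 e2 : nat -> R -> R -> R) : Prop :=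
  (forall t, 0 <= t <= T -> h 0%nat t = h0 t) /\
  (forall k : nat,
     dirichlet_error tau c lambda T a (h k) (e1 (S k)) /\
     neumann_error tau c lambda T a b (e1 (S k)) (e2 (S k)) /\
     (forall t, 0 <= t <= T ->
        h (S k) t = theta * e2 (S k) 0 t + (1 - theta) * h k t)).

Definition admissible (tau c lambda T a b theta : R) (h0 : R -> R) : Prop :=
  continuous_on (closed_interval 0 T) h0 /\
  exists (h : nat -> R -> R) (e1 e2 : nat -> R -> R -> R),
    dnwr_iteration tau c lambda T a b theta h0 h e1 e2.

Definition not_identically_zero (T : R) (h : R -> R) : Prop :=
  exists t, 0 <= t <= T /\ h t <> 0.

(* The supremum is finite for [h] continuous on [0, T]; [real] sends an
   infinite one to 0. *)
Definition sup_norm (T : R) (h : R -> R) : R :=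
  real (Lub_Rbar (fun y => exists t, 0 <= t <= T /\ y = Rabs (h t))).

Definition converges_linearly (tau c lambda T a b theta : R) : Prop :=
  forall h0 : R -> R,
    admissible tau c lambda T a b theta h0 ->
    not_identically_zero T h0 ->
    exists rho : R, 0 < rho < 1 /\
      forall (h : nat -> R -> R) (e1 e2 : nat -> R -> R -> R),
        dnwr_iteration tau c lambda T a b theta h0 h e1 e2 ->
        (forall k : nat, not_identically_zero T (h k)) /\
        is_lim_seq (fun k : nat => sup_norm T (h (S k)) / sup_norm T (h k)) rho.

Definition converges_within_two_iterations
    (tau c lambda T a b theta : R) : Prop :=
  forall h0 : R -> R,
    admissible tau c lambda T a b theta h0 ->
    forall (h : nat -> R -> R) (e1 e2 : nat -> R -> R -> R),
      dnwr_iteration tau c lambda T a b theta h0 h e1 e2 ->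
      forall k : nat, (2 <= k)%nat ->
        (forall x t, - a <= x <= 0 -> - tau <= t <= T -> e1 k x t = 0) /\
        (forall x t, 0 <= x <= b -> - tau <= t <= T -> e2 k x t = 0) /\
        (forall t, 0 <= t <= T -> h k t = 0).

(* Main.v *)
(* When a = b, the function w(x,t) = e_2(x,t) + e_1(-x,t) solves the homogeneous
   delayed wave equation on (0,b) with zero history, w_x(0,t) = 0 and
   w(b,t) = 0. The energy method, applied successively on time windows of length
   tau, gives w = 0. Hence e_2(0,t) = -h^{k-1}(t), so that
   h^k = (1 - 2 theta) h^{k-1}: the ratio of norms is |1 - 2 theta|, and
   theta = 1/2 yields h^1 = 0. *)
From Pilot Require Import Defs.
From Stdlib Require Import Reals Lra Lia.
From Coquelicot Require Import Coquelicot.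
(* [Rderiv.Dx] of the standard library shadows [Defs.Dx]. *)
Import Pilot.Defs.
Open Scope R_scope.

(** The obstacle is the edge of the space-time rectangle: derivatives there are one-sided, boundary
    data are prescribed only for [0 < t < T], and the equation holds only inside, whereas
    differentiation under the integral sign asks for continuity on full neighbourhoods. The energy
    argument is therefore stated for four functions, the first derivatives and their time
    derivatives, each continued continuously by clamping its arguments; space derivatives are used
    only inside, and values of the solution on the edge are recovered by continuity. The boundary
    enters only through equality of the energy flux at the two ends. This single condition covers
    both situations that occur: Neumann-Dirichlet for the reflected sum, and Dirichlet at both ends,
    which is what turns h^1 = 0 into vanishing subdomain errors from the second iteration on. *)

(** * Derivatives relative to a closed interval *)

Lemma locally_open_interval (p q x : R) :
  p < x < q -> locally x (fun y => p < y < q).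
Proof.
  intros Hx. apply filter_and; [apply (open_gt p) | apply (open_lt q)]; lra.
Qed.

Lemma locally_closed_interval (p q x : R) :
  p < x < q -> locally x (closed_interval p q).
Proof.
  intros Hx. apply filter_imp with (2 := locally_open_interval p q x Hx).
  intros y Hy. unfold closed_interval. lra.
Qed.

Lemma is_derive_on_eps (I : R -> Prop) (f : R -> R) (x l : R) :
  I x -> is_derive_on I f x l ->
  forall eps : posreal, exists d : posreal, forall y, I y -> Rabs (y - x) < d ->
    Rabs (f y - f x - (y - x) * l) <= eps * Rabs (y - x).
Proof.
  intros Ix [_ H] eps.
  assert (Hx : is_filter_lim (within I (locally x)) x).
  { intros P HP. unfold within. now apply filter_imp with (2 := HP). }
  destruct (H x Hx eps) as [d Hd].
  exists d. intros y Iy Hy. exact (Hd y Hy Iy).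
Qed.

Lemma is_derive_on_interior (p q : R) (f : R -> R) (x l : R) :
  p < x < q -> is_derive_on (closed_interval p q) f x l -> is_derive f x l.
Proof.
  intros Hx [Hl H]. split; [exact Hl |].
  intros y Hy eps.
  assert (Hy' : is_filter_lim (within (closed_interval p q) (locally x)) y).
  { intros P HP. unfold within. now apply filter_imp with (2 := Hy P HP). }
  generalize (filter_and _ _ (locally_closed_interval p q x Hx) (H y Hy' eps)).
  apply filter_imp. intros z [Hz Hz']. exact (Hz' Hz).
Qed.

Lemma exists_interior_near (p q x d : R) :
  p < q -> p <= x <= q -> 0 < d ->
  exists y, p < y < q /\ y <> x /\ Rabs (y - x) < d.
Proof.
  intros Hpq Hx Hd.
  (* The move goes toward the farther endpoint, so a quarter of the length cannot leave the
     interval. *)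
  destruct (Rle_lt_dec x ((p + q) / 2)) as [Hm | Hm].
  - exists (x + Rmin (d / 2) ((q - p) / 4)).
    unfold Rmin; destruct (Rle_dec (d / 2) ((q - p) / 4));
      (split; [lra |]); (split; [lra |]); rewrite Rabs_pos_eq; lra.
  - exists (x - Rmin (d / 2) ((q - p) / 4)).
    unfold Rmin; destruct (Rle_dec (d / 2) ((q - p) / 4));
      (split; [lra |]); (split; [lra |]); rewrite Rabs_left1; lra.
Qed.

(** Comparing both linear approximations at a nearby point [y] other than [x] gives |y - x| |l1 -
    l2| <= e |y - x|. Uniqueness is what makes the [iota] in [Derive_on] return the derivative. *)
Lemma is_derive_on_unique (p q : R) (f : R -> R) (x l1 l2 : R) :
  p < q -> p <= x <= q ->
  is_derive_on (closed_interval p q) f x l1 ->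
  is_derive_on (closed_interval p q) f x l2 -> l1 = l2.
Proof.
  intros Hpq Hx H1 H2.
  apply Rminus_diag_uniq, Rabs_eq_0.
  apply Rle_antisym; [| apply Rabs_pos].
  apply le_epsilon. intros e He.
  assert (He2 : 0 < e / 2) by lra.
  destruct (is_derive_on_eps _ _ _ _ Hx H1 (mkposreal _ He2)) as [d1 Hd1].
  destruct (is_derive_on_eps _ _ _ _ Hx H2 (mkposreal _ He2)) as [d2 Hd2].
  destruct (exists_interior_near p q x (Rmin d1 d2)) as (y & Hy & Hyx & Hd);
    [lra | lra | apply Rmin_pos; [apply d1 | apply d2] |].
  assert (Iy : closed_interval p q y) by (unfold closed_interval; lra).
  specialize (Hd1 y Iy (Rlt_le_trans _ _ _ Hd (Rmin_l _ _))).
  specialize (Hd2 y Iy (Rlt_le_trans _ _ _ Hd (Rmin_r _ _))).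
  simpl in Hd1, Hd2.
  assert (Hpos : 0 < Rabs (y - x)) by (apply Rabs_pos_lt; lra).
  apply Rmult_le_reg_l with (Rabs (y - x)); [exact Hpos |].
  rewrite <- Rabs_mult.
  replace ((y - x) * (l1 - l2)) with
    ((f y - f x - (y - x) * l2) - (f y - f x - (y - x) * l1)) by ring.
  eapply Rle_trans; [apply Rabs_triang |]. rewrite Rabs_Ropp. nra.
Qed.

Lemma Derive_on_unique (p q : R) (f : R -> R) (x l : R) :
  p < q -> p <= x <= q -> is_derive_on (closed_interval p q) f x l ->
  Derive_on (closed_interval p q) f x = l.
Proof.
  intros Hpq Hx H.
  apply (iota_unique (V := R_CompleteNormedModule)); [| exact H].
  intros l' H'. exact (is_derive_on_unique p q f x l' l Hpq Hx H' H).
Qed.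

Lemma Derive_on_correct (p q : R) (f : R -> R) (x : R) :
  p < q -> p <= x <= q -> ex_derive_on (closed_interval p q) f x ->
  is_derive_on (closed_interval p q) f x (Derive_on (closed_interval p q) f x).
Proof.
  intros Hpq Hx [l Hl]. now rewrite (Derive_on_unique p q f x l).
Qed.

Lemma is_derive_Derive_on (p q : R) (f : R -> R) (x : R) :
  p < x < q -> ex_derive_on (closed_interval p q) f x ->
  is_derive f x (Derive_on (closed_interval p q) f x).
Proof.
  intros Hx H. apply (is_derive_on_interior p q); [exact Hx |].
  apply Derive_on_correct; [lra | lra | exact H].
Qed.

(** Needed at [t = 0]: the history condition differentiates relative to [[-tau, T]], while [Dt] is
    taken relative to [[0, T]]. *)
Lemma is_derive_on_subset (I J : R -> Prop) (f : R -> R) (x l : R) :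
  (forall y, I y -> J y) -> I x -> is_derive_on J f x l -> is_derive_on I f x l.
Proof.
  intros HIJ Ix [Hl H]. split; [exact Hl |].
  intros y Hy eps.
  (* [filterdiff] quantifies over every limit [y] of the filter. Since [x] lies in [I], the filter
     within [I] is proper, so its limit is unique and [y] is [x]. *)
  assert (Hy' : is_filter_lim (within J (locally x)) y).
  { assert (ProperFilter (within I (locally x))).
    { constructor; [| apply within_filter, locally_filter].
      intros P [d Hd]. exists x. apply Hd; [apply ball_center | exact Ix]. }
    assert (y = x) as ->.
    { apply (is_filter_lim_unique (K := R_AbsRing) (V := R_NormedModule)
               (F := within I (locally x))).
      - exact Hy.
      - intros P HP. unfold within. now apply filter_imp with (2 := HP). }
    intros P HP. unfold within. now apply filter_imp with (2 := HP). }
  generalize (H y Hy' eps). unfold within.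
  apply filter_imp. auto.
Qed.

Lemma continuous_on_eq_closure (p q : R) (f g : R -> R) :
  p < q -> continuous_on (closed_interval p q) f ->
  continuous_on (closed_interval p q) g ->
  (forall x, p < x < q -> f x = g x) -> forall x, p <= x <= q -> f x = g x.
Proof.
  intros Hpq Hf Hg Heq x Hx.
  apply Rminus_diag_uniq, Rabs_eq_0.
  apply Rle_antisym; [| apply Rabs_pos].
  apply le_epsilon. intros e He.
  assert (He2 : 0 < e / 2) by lra.
  destruct (proj1 (filterlim_locally _ _) (Hf x Hx) (mkposreal _ He2)) as [d1 Hd1].
  destruct (proj1 (filterlim_locally _ _) (Hg x Hx) (mkposreal _ He2)) as [d2 Hd2].
  destruct (exists_interior_near p q x (Rmin d1 d2)) as (y & Hy & _ & Hd);
    [lra | lra | apply Rmin_pos; [apply d1 | apply d2] |].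
  assert (Iy : closed_interval p q y) by (unfold closed_interval; lra).
  specialize (Hd1 y (Rlt_le_trans _ _ _ Hd (Rmin_l _ _)) Iy).
  specialize (Hd2 y (Rlt_le_trans _ _ _ Hd (Rmin_r _ _)) Iy).
  change (Rabs (f y - f x) < e / 2) in Hd1.
  change (Rabs (g y - g x) < e / 2) in Hd2.
  replace (f x - g x) with ((g y - g x) - (f y - f x)) by (rewrite (Heq y Hy); ring).
  eapply Rle_trans; [apply Rabs_triang |]. rewrite Rabs_Ropp. lra.
Qed.

(** * Continuity on rectangles and extension by clamping *)

(** For [p <= q] this is the nearest-point projection onto the interval. It is 1-Lipschitz, so
    composing with it turns continuity on the interval into continuity at every real point. *)
Definition clamp (p q x : R) : R := Rmax p (Rmin x q).

Lemma clamp_in (p q x : R) : p <= q -> p <= clamp p q x <= q.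
Proof. unfold clamp, Rmax, Rmin; repeat destruct Rle_dec; lra. Qed.

Lemma clamp_id (p q x : R) : p <= x <= q -> clamp p q x = x.
Proof. unfold clamp, Rmax, Rmin; repeat destruct Rle_dec; lra. Qed.

Lemma clamp_lipschitz (p q x y : R) :
  p <= q -> Rabs (clamp p q x - clamp p q y) <= Rabs (x - y).
Proof.
  unfold clamp, Rmax, Rmin, Rabs;
    repeat destruct Rle_dec; repeat destruct Rcase_abs; lra.
Qed.

Lemma continuous_on_clamp (p q : R) (f : R -> R) (x : R) :
  p <= q -> continuous_on (closed_interval p q) f ->
  continuity_pt (fun y => f (clamp p q y)) x.
Proof.
  intros Hpq Hf. apply continuity_pt_filterlim.
  apply filterlim_comp with (2 := Hf (clamp p q x) (clamp_in p q x Hpq)).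
  intros P [d Hd]. exists d. intros y Hy. apply Hd; [| now apply clamp_in].
  exact (Rle_lt_trans _ _ _ (clamp_lipschitz p q y x Hpq) Hy).
Qed.

(* The time variable comes first, as the parameter of an integral in [x]. *)
Definition extension (p q T : R) (u : R -> R -> R) : R -> R -> R :=
  fun t x => u (clamp p q x) (clamp 0 T t).

Lemma extension_continuous (p q T : R) (u : R -> R -> R) (t x : R) :
  p <= q -> 0 <= T ->
  continuous_on2 (closed_interval p q) (closed_interval 0 T) u ->
  continuity_2d_pt (extension p q T u) t x.
Proof.
  intros Hpq HT Hu. apply continuity_2d_pt_filterlim. unfold extension.
  refine (filterlim_comp _ _ _
            (fun z : R * R => (clamp p q (snd z), clamp 0 T (fst z)))
            (fun z : R * R => u (fst z) (snd z)) _ _ _ _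
            (Hu (clamp p q x, clamp 0 T t) _)).
  - intros P [d Hd]. exists d. intros [s y] [Hs Hy].
    apply Hd.
    + split; [exact (Rle_lt_trans _ _ _ (clamp_lipschitz p q y x Hpq) Hy)
             | exact (Rle_lt_trans _ _ _ (clamp_lipschitz 0 T s t HT) Hs)].
    + split; now apply clamp_in.
  - split; now apply clamp_in.
Qed.

Lemma continuous_on2_line (I J : R -> Prop) (u : R -> R -> R) (x : R) :
  I x -> continuous_on2 I J u -> continuous_on J (u x).
Proof.
  intros Ix Hu t Jt.
  refine (filterlim_comp _ _ _ (fun s : R => (x, s))
            (fun z : R * R => u (fst z) (snd z)) _ _ _ _ (Hu (x, t) (conj Ix Jt))).
  intros P [d Hd]. exists d. intros s Hs Js. apply Hd; [| now split].
  split; [apply ball_center | exact Hs].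
Qed.

Lemma continuous_on2_column (I J : R -> Prop) (u : R -> R -> R) (t : R) :
  J t -> continuous_on2 I J u -> continuous_on I (fun x => u x t).
Proof.
  intros Jt Hu x Ix.
  refine (filterlim_comp _ _ _ (fun s : R => (s, t))
            (fun z : R * R => u (fst z) (snd z)) _ _ _ _ (Hu (x, t) (conj Ix Jt))).
  intros P [d Hd]. exists d. intros s Hs Is. apply Hd; [| now split].
  split; [exact Hs | apply ball_center].
Qed.

(** The factor [k] lets one statement serve the components of a reflected solution that keep their
    sign and those that change it. *)
Lemma continuous_on2_scal_reflect (p q : R) (J : R -> Prop) (u : R -> R -> R) (k : R) :
  continuous_on2 (closed_interval p q) J u ->
  continuous_on2 (closed_interval (- q) (- p)) J (fun x t => k * u (- x) t).
Proof.
  intros Hu [x t] [Hx Ht]; unfold closed_interval in Hx; simpl in Hx, Ht.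
  apply (filterlim_comp _ _ _ (fun z : R * R => u (- fst z) (snd z))
           (fun y => k * y) _ (locally (u (- x) t)));
    [| apply (filterlim_scal_r (V := R_NormedModule) k (u (- x) t))].
  assert (Hx' : closed_interval p q (- x)) by (unfold closed_interval; lra).
  refine (filterlim_comp _ _ _ (fun z : R * R => (- fst z, snd z))
            (fun z : R * R => u (fst z) (snd z)) _ _ _ _ (Hu (- x, t) (conj Hx' Ht))).
  intros P [d Hd]. exists d. intros [y s] [Hy Hs] [Iy Js]. simpl in *.
  unfold closed_interval in Iy. apply Hd.
  - split; [| exact Hs]. change (Rabs (- y - - x) < d).
    replace (- y - - x) with (- (y - x)) by ring. now rewrite Rabs_Ropp.
  - split; [| exact Js]. unfold closed_interval; simpl; lra.
Qed.

Lemma continuous_on2_plus (I J : R -> Prop) (u v : R -> R -> R) :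
  continuous_on2 I J u -> continuous_on2 I J v ->
  continuous_on2 I J (fun x t => u x t + v x t).
Proof.
  intros Hu Hv z Hz.
  eapply filterlim_comp_2; [exact (Hu z Hz) | exact (Hv z Hz) |].
  apply (filterlim_plus (V := R_NormedModule)).
Qed.

(** * Integrals, integrals with a parameter, and the energy identity *)

Lemma is_derive_locally_const (f : R -> R) (p q k x l : R) :
  p < x < q -> (forall y, p < y < q -> f y = k) -> is_derive f x l -> l = 0.
Proof.
  intros Hx Hf H. rewrite <- (is_derive_unique _ _ _ H). apply is_derive_unique.
  apply (is_derive_ext_loc (fun _ => k));
    [| apply (is_derive_const (V := R_NormedModule))].
  apply filter_imp with (2 := locally_open_interval p q x Hx).
  intros y Hy. symmetry. now apply Hf.
Qed.

Lemma is_derive_RInt_upper (f : R -> R) (p x : R) :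
  (forall y, continuity_pt f y) -> is_derive (fun y => RInt f p y) x (f x).
Proof.
  intros Hf.
  apply (is_derive_RInt (V := R_NormedModule) f _ p x);
    [| now apply continuity_pt_filterlim].
  apply filter_forall. intros y. apply (RInt_correct (V := R_CompleteNormedModule)).
  apply (ex_RInt_continuous (V := R_CompleteNormedModule)). intros z _.
  now apply continuity_pt_filterlim.
Qed.

Lemma ex_RInt_continuity (f : R -> R) (p q : R) :
  (forall y, continuity_pt f y) -> ex_RInt f p q.
Proof.
  intros Hf. apply (ex_RInt_continuous (V := R_CompleteNormedModule)). intros z _.
  now apply continuity_pt_filterlim.
Qed.

Lemma derive_zero_const (f : R -> R) (p q : R) :
  p <= q -> (forall x, p < x < q -> is_derive f x 0) ->
  (forall x, p <= x <= q -> continuity_pt f x) -> f q = f p.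
Proof.
  intros Hpq Hd Hc.
  destruct (MVT_gen f p q (fun _ => 0)) as (z & _ & Hz).
  - rewrite Rmin_left, Rmax_right by lra. exact Hd.
  - rewrite Rmin_left, Rmax_right by lra. exact Hc.
  - lra.
Qed.

(** Clamped functions may fail to be differentiable at [p] and [q], so the fundamental theorem is
    needed with derivatives inside only. The difference [RInt f p x - F x] is continuous with zero
    derivative inside, hence constant. *)
Lemma RInt_derive_interior (F f : R -> R) (p q : R) :
  p < q -> (forall x, continuity_pt f x) -> (forall x, continuity_pt F x) ->
  (forall x, p < x < q -> is_derive F x (f x)) -> RInt f p q = F q - F p.
Proof.
  intros Hpq Hf HF Hd.
  assert (H : RInt f p q - F q = RInt f p p - F p).
  { apply (derive_zero_const (fun x => RInt f p x - F x)); [lra | |].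
    - intros x Hx. replace 0 with (f x - f x) by ring.
      apply (is_derive_minus (V := R_NormedModule));
        [now apply is_derive_RInt_upper | now apply Hd].
    - intros x _. apply continuity_pt_minus; [| apply HF].
      apply continuity_pt_filterlim.
      apply (ex_derive_continuous (V := R_NormedModule)).
      exists (f x). now apply is_derive_RInt_upper. }
  rewrite RInt_point in H. unfold zero in H; simpl in H. lra.
Qed.

(** The integrals over [[p, y]] and [[y, q]] are nonnegative with sum zero, so the primitive
    vanishes inside and its derivative [f] with it. *)
Lemma RInt_nonneg_eq_0 (f : R -> R) (p q : R) :
  p < q -> (forall x, continuity_pt f x) -> (forall x, 0 <= f x) ->
  RInt f p q = 0 -> forall x, p < x < q -> f x = 0.
Proof.
  intros Hpq Hf Hpos H0 x Hx.
  assert (HF : forall y, p < y < q -> RInt f p y = 0).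
  { intros y Hy.
    assert (H := RInt_Chasles f p y q (ex_RInt_continuity f p y Hf)
                   (ex_RInt_continuity f y q Hf)).
    unfold plus in H; simpl in H.
    assert (0 <= RInt f p y)
      by (apply RInt_ge_0; [lra | now apply ex_RInt_continuity | auto]).
    assert (0 <= RInt f y q)
      by (apply RInt_ge_0; [lra | now apply ex_RInt_continuity | auto]).
    lra. }
  apply (is_derive_locally_const (fun y => RInt f p y) p q 0 x); trivial.
  now apply is_derive_RInt_upper.
Qed.

Lemma continuity_2d_pt_section (f : R -> R -> R) (x y : R) :
  continuity_2d_pt f x y -> continuity_pt (f x) y.
Proof.
  intros Hf. apply continuity_pt_filterlim.
  apply filterlim_locally. intros eps. destruct (Hf eps) as [d Hd].
  exists d. intros z Hz. apply Hd; [| exact Hz].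
  rewrite Rminus_diag, Rabs_R0. apply d.
Qed.

(** The energy is differentiated only at interior times; this supplies its continuity at the initial
    and final times, by uniform continuity over the compact range of [x]. *)
Lemma continuity_RInt_param (f : R -> R -> R) (p q t : R) :
  p < q -> (forall t x, continuity_2d_pt f t x) ->
  continuity_pt (fun s => RInt (f s) p q) t.
Proof.
  intros Hpq Hf. apply continuity_pt_filterlim.
  assert (Hc : forall s x, continuity_pt (f s) x)
    by (intros; now apply continuity_2d_pt_section).
  apply filterlim_locally. intros [e He].
  (* The factor 2 makes the final bound strict, since the integral estimate is not. *)
  assert (He' : 0 < e / (2 * (q - p))) by (apply Rdiv_lt_0_compat; lra).
  destruct (uniform_continuity_2d_1d' f p q t (fun x _ => Hf t x)
              (mkposreal _ He')) as [d Hd].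
  exists d. intros s Hs. change (Rabs (RInt (f s) p q - RInt (f t) p q) < e).
  change (Rabs (s - t) < d) in Hs. apply Rabs_lt_between in Hs.
  rewrite <- (RInt_minus (V := R_CompleteNormedModule)) by now apply ex_RInt_continuity.
  eapply Rle_lt_trans.
  - apply abs_RInt_le_const with (M := e / (2 * (q - p))); [lra | |].
    + apply (ex_RInt_minus (V := R_NormedModule)); now apply ex_RInt_continuity.
    + intros x Hx. left. apply (Hd x t x s); try lra.
      rewrite Rminus_diag, Rabs_R0. apply d.
  - replace ((q - p) * (e / (2 * (q - p)))) with (e / 2) by (field; lra). lra.
Qed.

(* Here [v], [g] stand for [u_t], [u_x], and [vt], [gt] for their time
   derivatives: the energy [int (v^2 + c^2 g^2)] has derivative
   [2 c^2 (v g)|_p^q = 0], since [v vt + c^2 g gt = c^2 (v g)_x]. *)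
Lemma wave_energy_zero (c p q s : R) (v g vt gt : R -> R -> R) :
  0 < c -> p < q -> 0 <= s ->
  (forall t x, continuity_2d_pt v t x) -> (forall t x, continuity_2d_pt g t x) ->
  (forall t x, continuity_2d_pt vt t x) -> (forall t x, continuity_2d_pt gt t x) ->
  (forall t x, 0 < t < s ->
     is_derive (fun r => v r x) t (vt t x) /\ is_derive (fun r => g r x) t (gt t x)) ->
  (forall t x, 0 < t < s -> p < x < q ->
     is_derive (v t) x (gt t x) /\
     exists gx, is_derive (g t) x gx /\ vt t x = c ^ 2 * gx) ->
  (forall t, 0 < t < s -> v t p * g t p = v t q * g t q) ->
  (forall x, p < x < q -> v 0 x = 0 /\ g 0 x = 0) ->
  forall t x, 0 <= t <= s -> p < x < q -> v t x = 0.
Proof.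
  intros Hc Hpq Hs Cv Cg Cvt Cgt Dt Dx Hflux Hinit.
  pose (f := fun t x => v t x * v t x + c ^ 2 * (g t x * g t x)).
  pose (ft := fun t x => 2 * (v t x * vt t x + c ^ 2 * (g t x * gt t x))).
  assert (Cf : forall t x, continuity_2d_pt f t x).
  { intros t x. unfold f.
    repeat (apply continuity_2d_pt_plus || apply continuity_2d_pt_mult
            || apply continuity_2d_pt_const || auto). }
  assert (Cft : forall t x, continuity_2d_pt ft t x).
  { intros t x. unfold ft.
    repeat (apply continuity_2d_pt_plus || apply continuity_2d_pt_mult
            || apply continuity_2d_pt_const || auto). }
  assert (Dft : forall t x, 0 < t < s ->
            is_derive (fun r => f r x) t (ft t x)).
  { intros t x Ht. destruct (Dt t x Ht) as [H1 H2]. unfold f, ft.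
    auto_derive.
    - repeat split; eexists; eassumption.
    - replace (Derive (fun r : R => v r x) t) with (vt t x)
        by (symmetry; now apply is_derive_unique).
      replace (Derive (fun r : R => g r x) t) with (gt t x)
        by (symmetry; now apply is_derive_unique).
      ring. }
  assert (Hzero : forall t, 0 < t < s -> RInt (ft t) p q = 0).
  { intros t Ht.
    rewrite (RInt_derive_interior (fun x => 2 * c ^ 2 * (v t x * g t x)) (ft t) p q).
    - rewrite (Hflux t Ht). apply Rminus_diag.
    - exact Hpq.
    - intros x. now apply continuity_2d_pt_section.
    - intros x. apply (continuity_2d_pt_section (fun t x => 2 * c ^ 2 * (v t x * g t x))).
      repeat (apply continuity_2d_pt_mult || apply continuity_2d_pt_const || auto).
    - intros x Hx. destruct (Dx t x Ht Hx) as (H1 & gx & H2 & H3).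
      unfold ft. rewrite H3. auto_derive.
      + repeat split; eexists; eassumption.
      + replace (Derive (fun y : R => v t y) x) with (gt t x)
          by (symmetry; now apply is_derive_unique).
        replace (Derive (fun y : R => g t y) x) with gx
          by (symmetry; now apply is_derive_unique).
        ring. }
  assert (HE : forall t, 0 <= t <= s -> RInt (f t) p q = 0).
  { intros t Ht. transitivity (RInt (f 0) p q).
    - apply (derive_zero_const (fun t => RInt (f t) p q)); [lra | |].
      + intros r Hr. assert (Hr0 : 0 < r < s) by lra. rewrite <- (Hzero r Hr0).
        assert (Hloc := locally_open_interval 0 s r Hr0).
        rewrite (RInt_ext (ft r) (fun x => Derive (fun u => f u x) r)).
        * apply is_derive_RInt_param.
          -- apply filter_imp with (2 := Hloc). intros u Hu x _.
             exists (ft u x). now apply Dft.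
          -- intros x _.
             apply continuity_2d_pt_ext_loc with ft; [| apply Cft].
             destruct Hloc as [d Hd]. exists d. intros u y Hu _.
             symmetry. apply is_derive_unique, Dft. now apply Hd.
          -- apply filter_forall. intros u. apply ex_RInt_continuity.
             intros x. now apply continuity_2d_pt_section.
        * intros x _.
          symmetry. apply is_derive_unique, Dft; lra.
      + intros r _. now apply continuity_RInt_param.
    - rewrite (RInt_ext _ (fun _ => 0)).
      + rewrite RInt_const. apply Rmult_0_r.
      + intros x Hx. rewrite Rmin_left, Rmax_right in Hx by lra.
        unfold f. destruct (Hinit x Hx) as [-> ->]. rewrite !Rmult_0_r. apply Rplus_0_r. }
  intros t x Ht Hx.
  assert (Hf : f t x = 0).
  { apply (RInt_nonneg_eq_0 (f t) p q); auto.
    - intros y. now apply continuity_2d_pt_section.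
    - intros y. unfold f. generalize (Rle_0_sqr (v t y)) (Rle_0_sqr (g t y)).
      unfold Rsqr. generalize (pow2_ge_0 c). nra. }
  unfold f in Hf.
  generalize (Rle_0_sqr (v t x)) (Rle_0_sqr (g t x)) (pow2_ge_0 c).
  unfold Rsqr. intros. apply Rsqr_0_uniq. unfold Rsqr. nra.
Qed.

(** * From classical solutions to the data of the energy method *)

Lemma locally_2d_open_rectangle (p q r s x t : R) :
  p < x < q -> r < t < s -> locally_2d (fun y z => p < y < q /\ r < z < s) x t.
Proof.
  intros Hx Ht.
  destruct (locally_open_interval p q x Hx) as [d1 H1].
  destruct (locally_open_interval r s t Ht) as [d2 H2].
  assert (Hd : 0 < Rmin d1 d2) by (apply Rmin_pos; [apply d1 | apply d2]).
  exists (mkposreal _ Hd). simpl. intros y z Hy Hz. split.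
  - apply H1. exact (Rlt_le_trans _ _ _ Hy (Rmin_l _ _)).
  - apply H2. exact (Rlt_le_trans _ _ _ Hz (Rmin_r _ _)).
Qed.

Lemma continuous_on2_interior (p q r s : R) (u : R -> R -> R) (x t : R) :
  p < x < q -> r < t < s ->
  continuous_on2 (closed_interval p q) (closed_interval r s) u ->
  continuity_2d_pt u x t.
Proof.
  intros Hx Ht Hu. apply continuity_2d_pt_filterlim.
  assert (Hin : rectangle (closed_interval p q) (closed_interval r s) (x, t))
    by (split; unfold closed_interval; simpl; lra).
  intros P HP. generalize (Hu (x, t) Hin P HP).
  destruct (locally_2d_open_rectangle p q r s x t Hx Ht) as [d Hd].
  unfold filtermap, within. intros H.
  assert (Hl : locally (x, t) (rectangle (closed_interval p q) (closed_interval r s))).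
  { exists d. intros [y z] [Hy Hz]. destruct (Hd y z Hy Hz).
    split; unfold closed_interval; simpl; lra. }
  generalize (filter_and _ _ H Hl). apply filter_imp. intros z [H1 H2]; auto.
Qed.

(** The energy identity needs (w_t)_x = (w_x)_t, whereas [C2_on] provides the two mixed derivatives
    separately. [Schwarz] speaks of [Derive], so each given derivative is first identified with it
    on a neighbourhood. *)
Lemma mixed_derivatives_eq (p q r s : R) (u ux ut uxt utx : R -> R -> R) :
  (forall x t, p < x < q -> r < t < s ->
     is_derive (fun y => u y t) x (ux x t) /\ is_derive (u x) t (ut x t) /\
     is_derive (ux x) t (uxt x t) /\ is_derive (fun y => ut y t) x (utx x t)) ->
  forall x t, p < x < q -> r < t < s ->
    continuity_2d_pt uxt x t -> continuity_2d_pt utx x t -> utx x t = uxt x t.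
Proof.
  intros D x t Hx Ht Cxt Ctx.
  assert (Dut : forall y z, p < y < q -> r < z < s ->
            is_derive (fun y => Derive (fun z => u y z) z) y (utx y z)).
  { intros y z Hy Hz. apply (is_derive_ext_loc (fun y => ut y z));
      [| now apply (D y z)].
    apply filter_imp with (2 := locally_open_interval p q y Hy). intros y' Hy'.
    symmetry. apply is_derive_unique. now apply (D y' z). }
  assert (Dux : forall y z, p < y < q -> r < z < s ->
            is_derive (fun z => Derive (fun y => u y z) y) z (uxt y z)).
  { intros y z Hy Hz. apply (is_derive_ext_loc (ux y));
      [| now apply (D y z)].
    apply filter_imp with (2 := locally_open_interval r s z Hz). intros z' Hz'.
    symmetry. apply is_derive_unique. now apply (D y z'). }
  rewrite <- (is_derive_unique _ _ _ (Dut x t Hx Ht)).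
  rewrite <- (is_derive_unique _ _ _ (Dux x t Hx Ht)).
  apply Schwarz.
  - apply locally_2d_impl with (2 := locally_2d_open_rectangle p q r s x t Hx Ht).
    apply locally_2d_forall. intros y z [Hy Hz].
    destruct (D y z Hy Hz) as (H1 & H2 & _).
    repeat split; eexists; eauto.
  - apply continuity_2d_pt_ext_loc with (2 := Ctx).
    apply locally_2d_impl with (2 := locally_2d_open_rectangle p q r s x t Hx Ht).
    apply locally_2d_forall. intros y z [Hy Hz].
    symmetry. apply is_derive_unique. now apply Dut.
  - apply continuity_2d_pt_ext_loc with (2 := Cxt).
    apply locally_2d_impl with (2 := locally_2d_open_rectangle p q r s x t Hx Ht).
    apply locally_2d_forall. intros y z [Hy Hz].
    symmetry. apply is_derive_unique. now apply Dux.
Qed.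

(* [v], [g], [vt], [gt] are [w_t], [w_x], [w_tt], [w_xt]. Away from the sides of
   the rectangle all derivatives are two-sided, so that sums and reflections of
   solutions need no relative derivatives. *)
Record delay_wave (tau c lambda T p q : R) (w v g vt gt : R -> R -> R) : Prop := {
  dw_cont_w : continuous_on2 (closed_interval p q) (closed_interval (- tau) T) w;
  dw_cont_v : continuous_on2 (closed_interval p q) (closed_interval 0 T) v;
  dw_cont_g : continuous_on2 (closed_interval p q) (closed_interval 0 T) g;
  dw_cont_vt : continuous_on2 (closed_interval p q) (closed_interval 0 T) vt;
  dw_cont_gt : continuous_on2 (closed_interval p q) (closed_interval 0 T) gt;
  dw_time : forall x t, p <= x <= q -> 0 < t < T ->
    is_derive (w x) t (v x t) /\ is_derive (v x) t (vt x t) /\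
    is_derive (g x) t (gt x t);
  dw_space : forall x t, p < x < q -> 0 < t < T ->
    is_derive (fun y => v y t) x (gt x t) /\
    exists gx, is_derive (fun y => g y t) x gx /\
      vt x t = c ^ 2 * gx + lambda * w x (t - tau);
  dw_history : forall x t, p < x < q -> - tau <= t <= 0 -> w x t = 0;
  dw_initial : forall x, p < x < q -> v x 0 = 0 /\ g x 0 = 0
}.

Lemma delay_wave_error_data (tau c lambda T p q : R) (e : R -> R -> R) :
  0 < tau -> 0 < T -> p < q -> delay_wave_error tau c lambda T p q e ->
  delay_wave tau c lambda T p q e
    (Dt (closed_interval 0 T) e) (Dx (closed_interval p q) e)
    (Dt (closed_interval 0 T) (Dt (closed_interval 0 T) e))
    (Dt (closed_interval 0 T) (Dx (closed_interval p q) e)).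
Proof.
  intros Htau HT Hpq (Ce & ((De & Cx & Ct) & (Dex & Cxx & Cxt) & (Det & Ctx & Ctt))
                         & Heq & Hhist).
  assert (DT : forall u x t, 0 < t < T -> ex_derive_on (closed_interval 0 T) (u x) t ->
             is_derive (u x) t (Dt (closed_interval 0 T) u x t)).
  { intros u x t Ht. apply is_derive_Derive_on. exact Ht. }
  assert (DX : forall u x t, p < x < q ->
             ex_derive_on (closed_interval p q) (fun y => u y t) x ->
             is_derive (fun y => u y t) x (Dx (closed_interval p q) u x t)).
  { intros u x t Hx. now apply (is_derive_Derive_on p q (fun y => u y t)). }
  assert (IX : forall x, p <= x <= q -> closed_interval p q x) by (intros; assumption).
  assert (IT : forall t, 0 <= t <= T -> closed_interval 0 T t) by (intros; assumption).
  constructor; try assumption.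
  - intros x t Hx Ht.
    assert (IXx := IX x Hx). assert (ITt := IT t ltac:(lra)).
    split; [| split]; apply DT; trivial; [now apply De | now apply Det | now apply Dex].
  - intros x t Hx Ht.
    assert (IXx := IX x ltac:(lra)). assert (ITt := IT t ltac:(lra)).
    split.
    + rewrite <- (mixed_derivatives_eq p q 0 T e (Dx (closed_interval p q) e)
        (Dt (closed_interval 0 T) e)
        (Dt (closed_interval 0 T) (Dx (closed_interval p q) e))
        (Dx (closed_interval p q) (Dt (closed_interval 0 T) e))); trivial.
      * apply DX; [exact Hx | now apply Det].
      * intros y s Hy Hs.
        assert (IXy := IX y ltac:(lra)). assert (ITs := IT s ltac:(lra)).
        split; [| split; [| split]]; (apply DX || apply DT); trivial;
          [now apply De | now apply De | now apply Dex | now apply Det].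
      * now apply (continuous_on2_interior p q 0 T).
      * now apply (continuous_on2_interior p q 0 T).
    + exists (Dx (closed_interval p q) (Dx (closed_interval p q) e) x t). split.
      * apply DX; [exact Hx | now apply Dex].
      * generalize (Heq x t Hx Ht). lra.
  - intros x t Hx Ht. now apply Hhist.
  - intros x Hx. split.
    + apply Derive_on_unique; [lra | lra |].
      apply (is_derive_on_subset _ (closed_interval (- tau) T)).
      * unfold closed_interval; intros; lra.
      * apply IT; lra.
      * apply (Hhist x 0); [exact Hx | lra].
    (* The history vanishes at [t = 0] for every interior [x], so its space derivative does too. *)
    + apply (is_derive_locally_const (fun y => e y 0) p q 0 x); [exact Hx | |].
      * intros y Hy. apply (Hhist y 0); [exact Hy | lra].
      * apply DX; [exact Hx |]. apply De; [apply IX | apply IT]; lra.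
Qed.

(** * Superposition and reflection *)

Lemma delay_wave_plus (tau c lambda T p q : R)
    (w1 v1 g1 vt1 gt1 w2 v2 g2 vt2 gt2 : R -> R -> R) :
  delay_wave tau c lambda T p q w1 v1 g1 vt1 gt1 ->
  delay_wave tau c lambda T p q w2 v2 g2 vt2 gt2 ->
  delay_wave tau c lambda T p q
    (fun x t => w1 x t + w2 x t) (fun x t => v1 x t + v2 x t)
    (fun x t => g1 x t + g2 x t) (fun x t => vt1 x t + vt2 x t)
    (fun x t => gt1 x t + gt2 x t).
Proof.
  intros [A1 A2 A3 A4 A5 Ht1 Hs1 Hh1 Hi1] [B1 B2 B3 B4 B5 Ht2 Hs2 Hh2 Hi2].
  constructor; try now apply continuous_on2_plus.
  - intros x t Hx Ht.
    destruct (Ht1 x t Hx Ht) as (H1 & H2 & H3), (Ht2 x t Hx Ht) as (K1 & K2 & K3).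
    split; [| split]; now apply (is_derive_plus (V := R_NormedModule)).
  - intros x t Hx Ht.
    destruct (Hs1 x t Hx Ht) as (H1 & gx1 & H2 & H3).
    destruct (Hs2 x t Hx Ht) as (K1 & gx2 & K2 & K3).
    split; [now apply (is_derive_plus (V := R_NormedModule)) |].
    exists (gx1 + gx2). split; [now apply (is_derive_plus (V := R_NormedModule)) |].
    rewrite H3, K3. ring.
  - intros x t Hx Ht. rewrite (Hh1 x t Hx Ht), (Hh2 x t Hx Ht). ring.
  - intros x Hx. destruct (Hi1 x Hx) as [-> ->], (Hi2 x Hx) as [-> ->]. lra.
Qed.

Lemma is_derive_reflect (f : R -> R) (x l : R) (k : R) :
  is_derive f (- x) l -> is_derive (fun y => k * f (- y)) x (- k * l).
Proof.
  intros H. auto_derive; [now exists l |].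
  replace (Derive (fun y : R => f y) (- x)) with l
    by (symmetry; now apply is_derive_unique).
  ring.
Qed.

(** Each space derivative changes sign under reflection, so w_x and w_xt carry [-1] while w_xx is
    unaffected and the equation persists. The factors [1] give all five components the common shape
    [k * u (- x) t]. *)
Lemma delay_wave_reflect (tau c lambda T p q : R) (w v g vt gt : R -> R -> R) :
  delay_wave tau c lambda T p q w v g vt gt ->
  delay_wave tau c lambda T (- q) (- p)
    (fun x t => 1 * w (- x) t) (fun x t => 1 * v (- x) t)
    (fun x t => -1 * g (- x) t) (fun x t => 1 * vt (- x) t)
    (fun x t => -1 * gt (- x) t).
Proof.
  intros [A1 A2 A3 A4 A5 Ht1 Hs1 Hh1 Hi1].
  constructor; try now apply continuous_on2_scal_reflect.
  - intros x t Hx Ht. assert (Hx' : p <= - x <= q) by lra.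
    destruct (Ht1 (- x) t Hx' Ht) as (H1 & H2 & H3).
    split; [| split]; now apply is_derive_scal.
  - intros x t Hx Ht. assert (Hx' : p < - x < q) by lra.
    destruct (Hs1 (- x) t Hx' Ht) as (H1 & gx1 & H2 & H3).
    split.
    + now apply (is_derive_reflect (fun y => v y t)).
    + exists gx1. split; [| rewrite H3; ring].
      replace gx1 with (- -1 * gx1) by ring.
      now apply (is_derive_reflect (fun y => g y t)).
  - intros x t Hx Ht. rewrite (Hh1 (- x) t); lra.
  - intros x Hx. destruct (Hi1 (- x)) as [-> ->]; lra.
Qed.

(** * Uniqueness for the delayed wave equation and its consequences *)

Lemma delay_wave_zero (tau c lambda T p q : R) (w v g vt gt : R -> R -> R) :
  0 < tau -> 0 < c -> 0 < T -> p < q ->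
  delay_wave tau c lambda T p q w v g vt gt ->
  (forall t, 0 < t < T -> v p t * g p t = v q t * g q t) ->
  forall x t, p <= x <= q -> - tau <= t <= T -> w x t = 0.
Proof.
  intros Htau Hc HT Hpq [Cw Cv Cg Cvt Cgt Dtime Dspace Hhist Hinit] Hflux.
  (* Method of steps: on the next window of length [tau] the delayed term vanishes. *)
  assert (Hsteps : forall n x t, p < x < q -> - tau <= t <= T -> t <= INR n * tau ->
            w x t = 0).
  { induction n as [| n IH]; intros x t Hx Ht Htn.
    { apply Hhist; [exact Hx |]. simpl in Htn. lra. }
    destruct (Rle_lt_dec t 0) as [Ht0 | Ht0]; [apply Hhist; lra |].
    rewrite S_INR in Htn.
    (* The energy argument runs over all of [[0, t]], not just the last window: for [0 < s < t] the
       time [s - tau] is below [INR n * tau], where the induction hypothesis applies. Initial data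
       are thus needed at time 0 only. *)
    assert (Hv : forall r, 0 <= r <= t -> v x r = 0).
    { intros r Hr.
      assert (H : extension p q T v r x = 0).
      { apply (wave_energy_zero c p q t (extension p q T v) (extension p q T g)
                 (extension p q T vt) (extension p q T gt));
          try lra; try (intros; apply extension_continuous; auto; lra).
        - intros s y Hs. assert (HsT : 0 < s < T) by lra.
          destruct (Dtime (clamp p q y) s (clamp_in p q y (Rlt_le _ _ Hpq)) HsT)
            as (_ & H1 & H2).
          unfold extension. rewrite (clamp_id 0 T s) by lra.
          split; [apply (is_derive_ext_loc (v (clamp p q y)))
                 | apply (is_derive_ext_loc (g (clamp p q y)))]; trivial;
            apply filter_imp with (2 := locally_open_interval 0 T s HsT);
            intros s' Hs'; now rewrite (clamp_id 0 T s') by lra.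
        - intros s y Hs Hy. assert (HsT : 0 < s < T) by lra.
          destruct (Dspace y s Hy HsT) as (H1 & gx & H2 & H3).
          unfold extension. rewrite (clamp_id 0 T s), (clamp_id p q y) by lra.
          split; [| exists gx; split].
          + apply (is_derive_ext_loc (fun y => v y s)); trivial.
            apply filter_imp with (2 := locally_open_interval p q y Hy).
            intros y' Hy'. now rewrite clamp_id by lra.
          + apply (is_derive_ext_loc (fun y => g y s)); trivial.
            apply filter_imp with (2 := locally_open_interval p q y Hy).
            intros y' Hy'. now rewrite clamp_id by lra.
          + rewrite H3, (IH y (s - tau)) by lra. ring.
        - intros s Hs. unfold extension.
          rewrite (clamp_id 0 T s), (clamp_id p q p), (clamp_id p q q) by lra.
          apply Hflux. lra.
        - intros y Hy. unfold extension.
          rewrite (clamp_id 0 T 0), (clamp_id p q y) by lra. now apply Hinit. }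
      unfold extension in H. now rewrite !clamp_id in H by lra. }
    (* With w_t = 0, [w] keeps its value at time 0. Clamping time gives the two-sided continuity
       that would otherwise be unknown at [t = T]. *)
    rewrite <- (Hhist x 0), <- (clamp_id (- tau) T t), <- (clamp_id (- tau) T 0) by lra.
    apply (derive_zero_const (fun r => w x (clamp (- tau) T r))); [lra | |].
    - intros r Hr. apply (is_derive_ext_loc (w x)).
      + apply filter_imp with (2 := locally_open_interval 0 t r Hr).
        intros r' Hr'. now rewrite clamp_id by lra.
      + rewrite <- (Hv r) by lra. apply (proj1 (Dtime x r ltac:(lra) ltac:(lra))).
    - intros r _. apply (continuous_on_clamp (- tau) T (w x)); [lra |].
      apply (continuous_on2_line (closed_interval p q)); [| exact Cw].
      unfold closed_interval; lra. }
  intros x t Hx Ht.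
  apply (continuous_on_eq_closure p q (fun x => w x t) (fun _ => 0)); trivial.
  - apply (continuous_on2_column _ (closed_interval (- tau) T)); [exact Ht | exact Cw].
  - intros y _. apply filterlim_const.
  - intros y Hy. destruct (INR_unbounded (t / tau)) as [n Hn].
    apply (Hsteps n); trivial.
    apply Rmult_le_reg_r with (/ tau); [now apply Rinv_0_lt_compat |].
    rewrite Rmult_assoc, Rinv_r, Rmult_1_r by lra. left; exact Hn.
Qed.

(** Both traces are constant in time, so w_t, and with it the flux, vanishes at both ends. *)
Lemma dirichlet_error_zero (tau c lambda T a : R) (h : R -> R) (e : R -> R -> R) :
  0 < tau -> 0 < c -> 0 < T -> 0 < a -> dirichlet_error tau c lambda T a h e ->
  (forall t, 0 < t < T -> h t = 0) ->
  forall x t, - a <= x <= 0 -> - tau <= t <= T -> e x t = 0.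
Proof.
  intros Htau Hc HT Ha [He Hb] Hh.
  assert (Ha0 : - a < 0) by lra.
  assert (D := delay_wave_error_data tau c lambda T (- a) 0 e Htau HT Ha0 He).
  apply (delay_wave_zero _ _ _ _ _ _ _ _ _ _ _ Htau Hc HT Ha0 D).
  intros t Ht.
  assert (H0 : Dt (closed_interval 0 T) e 0 t = 0).
  { apply (is_derive_locally_const (e 0) 0 T 0 t); [exact Ht | |].
    - intros s Hs. rewrite (proj2 (Hb s Hs)). now apply Hh.
    - apply (proj1 (dw_time _ _ _ _ _ _ _ _ _ _ _ D 0 t ltac:(lra) Ht)). }
  assert (Ha' : Dt (closed_interval 0 T) e (- a) t = 0).
  { apply (is_derive_locally_const (e (- a)) 0 T 0 t); [exact Ht | |].
    - intros s Hs. apply (Hb s Hs).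
    - apply (proj1 (dw_time _ _ _ _ _ _ _ _ _ _ _ D (- a) t ltac:(lra) Ht)). }
  rewrite H0, Ha'. ring.
Qed.

Lemma neumann_error_reflection (tau c lambda T a : R) (h : R -> R)
    (e1 e2 : R -> R -> R) :
  0 < tau -> 0 < c -> 0 < T -> 0 < a ->
  dirichlet_error tau c lambda T a h e1 -> neumann_error tau c lambda T a a e1 e2 ->
  forall x t, 0 <= x <= a -> - tau <= t <= T -> e2 x t = - e1 (- x) t.
Proof.
  intros Htau Hc HT Ha [He1 Hb1] [He2 Hb2] x t Hx Ht.
  assert (Ha0 : - a < 0) by lra.
  assert (D1 := delay_wave_reflect _ _ _ _ _ _ _ _ _ _ _
    (delay_wave_error_data tau c lambda T (- a) 0 e1 Htau HT Ha0 He1)).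
  rewrite Ropp_0, Ropp_involutive in D1.
  assert (D := delay_wave_plus _ _ _ _ _ _ _ _ _ _ _ _ _ _ _ _
    (delay_wave_error_data tau c lambda T 0 a e2 Htau HT Ha He2) D1).
  assert (H := delay_wave_zero _ _ _ _ _ _ _ _ _ _ _ Htau Hc HT Ha D).
  enough (e2 x t + 1 * e1 (- x) t = 0) by lra.
  apply H; trivial. clear x t Hx Ht H.
  (* Each end kills a different factor of the flux: at [x = 0] the Neumann condition cancels the
     space derivatives, and at [x = a] the zero traces make the time derivative vanish. *)
  intros t Ht. rewrite (proj1 (Hb2 t Ht)), Ropp_0.
  assert (Hv : Dt (closed_interval 0 T) e2 a t
                 + 1 * Dt (closed_interval 0 T) e1 (- a) t = 0).
  { apply (is_derive_locally_const (fun s => e2 a s + 1 * e1 (- a) s) 0 T 0 t);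
      [exact Ht | |].
    - intros s Hs. rewrite (proj2 (Hb2 s Hs)), (proj1 (Hb1 s Hs)). ring.
    - apply (proj1 (dw_time _ _ _ _ _ _ _ _ _ _ _ D a t ltac:(lra) Ht)). }
  rewrite Hv. ring.
Qed.

(** The Dirichlet condition ties [e1] to [h] only for [0 < t < T], but the update of [h] also uses
    [t = 0] and [t = T]; continuity of both sides closes the gap. *)
Lemma neumann_error_trace (tau c lambda T a : R) (h : R -> R) (e1 e2 : R -> R -> R) :
  0 < tau -> 0 < c -> 0 < T -> 0 < a -> continuous_on (closed_interval 0 T) h ->
  dirichlet_error tau c lambda T a h e1 -> neumann_error tau c lambda T a a e1 e2 ->
  forall t, 0 <= t <= T -> e2 0 t = - h t.
Proof.
  intros Htau Hc HT Ha Ch He1 He2 t Ht.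
  rewrite (neumann_error_reflection tau c lambda T a h e1 e2), Ropp_0 by (trivial; lra).
  f_equal. destruct He1 as [(Ce & _) Hb].
  apply (continuous_on_eq_closure 0 T (e1 0) h); trivial.
  - intros s Hs P HP.
    assert (Hs' : closed_interval (- tau) T s) by (unfold closed_interval in *; lra).
    assert (H0 : closed_interval (- a) 0 0) by (unfold closed_interval in *; lra).
    generalize (continuous_on2_line _ _ _ 0 H0 Ce s Hs' P HP).
    unfold filtermap, within. apply filter_imp. intros r Hr Ir. apply Hr.
    unfold closed_interval in *; lra.
  - intros s Hs. apply (Hb s Hs).
Qed.

(** * The interface recursion and its norms *)

Lemma continuous_on_ext_scal (p q k : R) (f g : R -> R) :
  continuous_on (closed_interval p q) f ->
  (forall t, p <= t <= q -> g t = k * f t) -> continuous_on (closed_interval p q) g.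
Proof.
  intros Hf Hg t Ht.
  rewrite (Hg t Ht).
  apply (filterlim_within_ext _ (fun t => k * f t)).
  - intros s Hs. symmetry. now apply Hg.
  - exact (filterlim_comp _ _ _ _ _ _ _ _ (Hf t Ht)
             (filterlim_scal_r (V := R_NormedModule) k (f t))).
Qed.

(** Only [h0] is given as continuous. Continuity of [h k] is carried through the induction, because
    the trace identity at the end times requires it and the resulting scaling passes it on. *)
Lemma dnwr_iteration_step (tau c lambda T a theta : R) (h0 : R -> R)
    (h : nat -> R -> R) (e1 e2 : nat -> R -> R -> R) :
  0 < tau -> 0 < c -> 0 < T -> 0 < a -> continuous_on (closed_interval 0 T) h0 ->
  dnwr_iteration tau c lambda T a a theta h0 h e1 e2 ->
  forall k, continuous_on (closed_interval 0 T) (h k) /\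
    forall t, 0 <= t <= T -> h (S k) t = (1 - 2 * theta) * h k t.
Proof.
  intros Htau Hc HT Ha C0 [H0 Hit].
  assert (step : forall k, continuous_on (closed_interval 0 T) (h k) ->
            forall t, 0 <= t <= T -> h (S k) t = (1 - 2 * theta) * h k t).
  { intros k Ck t Ht. destruct (Hit k) as (HD & HN & Hu).
    rewrite (Hu t Ht).
    rewrite (neumann_error_trace tau c lambda T a (h k) (e1 (S k)) (e2 (S k)))
      by trivial.
    ring. }
  induction k as [| k [Ck Hk]].
  - assert (continuous_on (closed_interval 0 T) (h 0%nat)).
    { apply (continuous_on_ext_scal 0 T 1 h0); trivial.
      intros t Ht. rewrite (H0 t Ht). ring. }
    auto.
  - assert (continuous_on (closed_interval 0 T) (h (S k)))
      by now apply (continuous_on_ext_scal 0 T (1 - 2 * theta) (h k)).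
    auto.
Qed.

(** An attained maximum is a finite least upper bound, so the default value of [real] does not
    intervene. *)
Lemma sup_norm_attained (T : R) (h : R -> R) (m : R) :
  0 <= m <= T -> (forall t, 0 <= t <= T -> Rabs (h t) <= Rabs (h m)) ->
  sup_norm T h = Rabs (h m).
Proof.
  intros Hm Hmax. unfold sup_norm.
  rewrite (is_lub_Rbar_unique _ (Finite (Rabs (h m)))); [reflexivity |].
  split.
  - intros y (t & Ht & ->). now apply Hmax.
  - intros b Hb. apply Hb. now exists m.
Qed.

Lemma continuous_on_max_abs (T : R) (h : R -> R) :
  0 <= T -> continuous_on (closed_interval 0 T) h ->
  exists m, 0 <= m <= T /\ forall t, 0 <= t <= T -> Rabs (h t) <= Rabs (h m).
Proof.
  intros HT Ch.
  destruct (continuity_ab_maj (fun t => Rabs (h (clamp 0 T t))) 0 T HT)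
    as (m & Hmax & Hm).
  - intros t _. apply (continuity_pt_comp (fun t => h (clamp 0 T t)) Rabs).
    + now apply continuous_on_clamp.
    + apply Rcontinuity_abs.
  - exists m. split; [exact Hm |]. intros t Ht.
    generalize (Hmax t Ht). now rewrite !clamp_id.
Qed.

Theorem theorem3 (tau c lambda T a b theta : R)
    (Htau : 0 < tau) (Hc : 0 < c) (HT : 0 < T) (Ha : 0 < a) (Hb : 0 < b)
    (Hab : a = b) :
  (0 < theta < 1 -> theta <> 1 / 2 ->
     converges_linearly tau c lambda T a b theta) /\
  (theta = 1 / 2 ->
     converges_within_two_iterations tau c lambda T a b theta).
Proof.
  subst b. split.
  - intros Hth Hne h0 [C0 _] Hnz.
    assert (Hr : 1 - 2 * theta <> 0) by lra.
    exists (Rabs (1 - 2 * theta)). split.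
    { split; [now apply Rabs_pos_lt | apply Rabs_def1; lra]. }
    intros h e1 e2 Hit.
    assert (step := dnwr_iteration_step tau c lambda T a theta h0 h e1 e2
                      Htau Hc HT Ha C0 Hit).
    assert (Hk : forall k, not_identically_zero T (h k)).
    { induction k as [| k (t & Ht & Hkt)].
      - destruct Hnz as (t & Ht & Hkt). exists t. split; [exact Ht |].
        now rewrite (proj1 Hit t Ht).
      - exists t. split; [exact Ht |]. rewrite (proj2 (step k) t Ht).
        now apply Rmult_integral_contrapositive_currified. }
    split; [exact Hk |].
    apply is_lim_seq_ext with (2 := is_lim_seq_const _). intros k.
    destruct (step k) as [Ck Hs], (Hk k) as (t & Ht & Hkt).
    (* Scaling preserves the maximizer of the absolute value, so one [m] serves both norms and the
       quotient is the same for every [k]. *)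
    destruct (continuous_on_max_abs T (h k) (Rlt_le _ _ HT) Ck) as (m & Hm & Hmax).
    rewrite (sup_norm_attained T (h k) m Hm Hmax).
    rewrite (sup_norm_attained T (h (S k)) m Hm).
    + rewrite (Hs m Hm), Rabs_mult. field.
      assert (0 < Rabs (h k t)) by now apply Rabs_pos_lt.
      specialize (Hmax t Ht). lra.
    + intros s Hs'. rewrite (Hs m Hm), (Hs s Hs'), !Rabs_mult.
      apply Rmult_le_compat_l; [apply Rabs_pos | now apply Hmax].
  - intros Hth h0 [C0 _] h e1 e2 Hit.
    assert (step := dnwr_iteration_step tau c lambda T a theta h0 h e1 e2
                      Htau Hc HT Ha C0 Hit).
    assert (Hh : forall k t, 0 <= t <= T -> h (S k) t = 0).
    { intros k t Ht. rewrite (proj2 (step k) t Ht), Hth. field. }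
    (* [h] vanishes from index 1 on, but [e1] at a given index is driven by the preceding [h]; hence
       the subdomain errors vanish only from index 2. *)
    intros [| [| k]] Hk; [lia | lia |].
    destruct (proj2 Hit (S k)) as (HD & HN & _).
    assert (He1 : forall x t, - a <= x <= 0 -> - tau <= t <= T ->
              e1 (S (S k)) x t = 0).
    { apply (dirichlet_error_zero tau c lambda T a (h (S k))); trivial.
      intros t Ht. apply Hh. lra. }
    split; [exact He1 | split; [| apply Hh]].
    intros x t Hx Ht.
    rewrite (neumann_error_reflection tau c lambda T a (h (S k))
               (e1 (S (S k))) (e2 (S (S k)))) by trivial.
    rewrite He1 by lra. ring.
Qed.
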